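(* Given natural numbers $k,C$ there exists a constant $C'=C'(k,C)$ such that every group $N\in\mathcal{N}_{k,C}$ has a subgroup $N'\leq N$ satisfying $[N:N']\leq C'$ and $d(N')\leq 1+k(5k+1)/2$.
   Context: For a finite group $G$, $d(G)$ denotes the minimal size of a generating set of $G$ (with $d=0$ for the trivial group). Given natural numbers $k,C$, $\mathcal{N}_{k,C}$ denotes the collection of all finite nilpotent groups $N$ such that every abelian subgroup $A\leq N$ has a subgroup $B\leq A$ satisfying $[A:B]\leq C$ and $d(B)\leq k$. *)

(* Defs.v *)
From mathcomp Require Import all_boot all_fingroup all_solvable.

Set Implicit Arguments.
Unset Strict Implicit.
Unset Printing Implicit Defensive.

Local Open Scope group_scope.

(* [in_class_N k C N] is membership of N in the class N_{k,C}; the minimal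
   number of generators d(G) is the library's generator rank ['m(G)]. *)
Definition in_class_N (k C : nat) (gT : finGroupType) (N : {group gT}) : Prop :=
  nilpotent N /\
  forall A : {group gT}, A \subset N -> abelian A ->
    exists B : {group gT},
      [/\ B \subset A, (#|A : B| <= C)%N & ('m(B) <= k)%N].

(* Main.v *)
Require Import Defs.
From mathcomp Require Import all_boot all_fingroup all_solvable.
From mathcomp Require Import zify.

(* Let P be a Sylow p-subgroup of N, A a maximal normal abelian subgroup of P
   and B <= A as in the definition of N_{k,C}, with |A : B| = p^e. The subgroup
   B0 of p^e-th powers of A lies in B, so that d(B0) <= k, it is normal in P, and
   |C_P(B0) : B0| is bounded because C_P(A) = A. If lifts of generators of
   P / C_P(B0) and generators of B0 generate Q, then |P : Q| <= |C_P(B0) : B0|;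
   for p > C one has e = 0, B0 = A and Q = P. To bound d(P / C_P(B0)), filter P
   by the centralisers K_i of B0 / B0^(p^i). The quotient K_0 / K_1 is a p-group
   of automorphisms of an elementary abelian group of rank <= k, contributing
   k(k-1)/2; K_1 / K_2 contributes k^2. For i >= 2, taking p-th powers sends
   1 + p^i w to 1 + p^(i+1) w modulo p^(i+2), so the "symbols" w of the elements
   of K_i form an increasing chain of subgroups of B0^k containing (B0^p)^k;
   adapting generators to this chain shows that all of K_2 / C_P(B0) contributes
   only another k^2. A nilpotent group is the product of its Sylow subgroups,
   and d is the maximum over the coprime factors. *)

Local Open Scope group_scope.

(** * Generation and centralisers in p-groups *)

(** Adjoining an element outside the current subgroup multiplies its order by at least p, so the
    index is exhausted after at most [logn p #|G : H|] additions. *)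
Lemma pgroup_gen_index (p : nat) (gT : finGroupType) (G H : {group gT}) :
  p.-group G -> H \subset G ->
  exists S : {set gT},
    [/\ S \subset G, (#|S| <= logn p #|G : H|)%N & <<S :|: H>> = G].
Proof.
move=> pG; have [m] := ubnP #|G : H|; elim: m H => // m IHm H ltHm sHG.
have [sGH | /subsetPn[x Gx notHx]] := boolP (G \subset H).
  exists set0; rewrite sub0set cards0 set0U genGid; split=> //.
  by apply/eqP; rewrite eqEsubset sHG.
pose L := <<x |: H>>%G.
have sHL : H \subset L by rewrite (subset_trans (subsetUr [set x] H)) ?subset_gen.
have Lx : x \in L by rewrite mem_gen ?setU11.
have sLG : L \subset G by rewrite gen_subG subUset sub1set Gx.
have prHL : (1 < #|L : H|)%N.
  by rewrite indexg_gt1; apply: contra notHx => /subsetP->.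
have idx : (#|G : L| * #|L : H| = #|G : H|)%N by rewrite Lagrange_index.
have ltL : (#|G : L| < #|G : H|)%N by rewrite -idx ltn_Pmulr.
have [S [sSG cS genS]] := IHm L (leq_trans ltL ltHm) sLG.
exists (x |: S); split.
- by rewrite subUset sub1set Gx.
- rewrite -idx lognM // (leq_trans (n := #|S|.+1)) //.
    by rewrite cardsU1 -add1n leq_add2r leq_b1.
  rewrite -addn1 leq_add // lt0n; apply: contraL prHL => /eqP l0.
  have pL := pgroupS sLG pG.
  have ntL : L :!=: 1.
    by apply: contraNneq notHx => L1; rewrite L1 inE in Lx; rewrite (eqP Lx) group1.
  have [p_pr _ _] := pgroup_pdiv pL ntL.
  have [e De] : {e | #|L : H| = (p ^ e)%N}.
    by apply/p_natP/(pnat_dvd (dvdn_indexg _ _)).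
  by move: l0; rewrite De pfactorK // => ->.
- apply/eqP; rewrite eqEsubset gen_subG !subUset sub1set Gx sSG sHG /= -genS.
  rewrite gen_subG subUset gen_subG subUset sub1set.
  rewrite mem_gen ?inE ?eqxx // -setUA.
  rewrite (subset_trans _ (subset_gen _)) ?subsetUr //=; last first.
    by rewrite setUCA subsetUl.
  by rewrite (subset_trans _ (subset_gen _)) // setUA subsetUr.
Qed.

(** Induction along a chain of normal subgroups of [P]: if [W] has index p in [V] and [v] lies in
    [V] outside [W], then ['C_P(V)] is the stabiliser of [v] in ['C_P(W)]. The orbit of [v] stays in
    the coset [v *: W], so this step adds at most n to the logarithm, and the sum is a binomial
    coefficient. *)
Lemma logn_index_cent (p n : nat) (gT : finGroupType) (P V : {group gT}) :
  p.-group P -> V <| P -> #|V| = (p ^ n)%N ->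
  (logn p #|P : 'C_P(V)| <= 'C(n, 2))%N.
Proof.
move=> pP; elim: n V => [|n IHn] V nVP cV.
  have -> : V :=: 1 by apply/eqP; rewrite trivg_card1 cV.
  by rewrite cent1T setIT indexgg logn1.
have [-> | ntV] := eqVneq (V : {set gT}) 1.
  by rewrite cent1T setIT indexgg logn1.
have pV := pgroupS (normal_sub nVP) pP.
have [p_pr _ _] := pgroup_pdiv pV ntV.
have [|W [sWV nWP cW]] := @normal_pgroup p gT n P V pP nVP.
  by rewrite cV pfactorK.
have sCVW : 'C_P(V) \subset 'C_P(W) by rewrite setIS ?centS.
rewrite -(Lagrange_index (subsetIl P 'C(W)) sCVW) lognM // binS bin1.
apply: leq_add; first exact: IHn.
have idxVW : #|V : W| = p.
  by rewrite -divgS // cV cW expnS mulnK // expn_gt0 prime_gt0.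
have [v Vv notWv] : exists2 v, v \in V & v \notin W.
  by apply/subsetPn; rewrite -indexg_eq1 idxVW; case: (p) p_pr => [|[]].
have defV : V :=: <<v |: W>>.
  apply/eqP; rewrite eqEsubset gen_subG subUset sub1set Vv sWV !andbT.
  have sWL : W \subset <<v |: W>> := subset_trans (subsetUr _ _) (subset_gen _).
  have sLV : <<v |: W>> \subset V by rewrite gen_subG subUset sub1set Vv.
  have : (#|V : <<v |: W>>| %| p)%N by rewrite -idxVW indexgS.
  case/primeP: (p_pr) => _ dvdp /dvdp/orP[].
    by rewrite indexg_eq1.
  rewrite -idxVW -{1}(Lagrange_index sLV sWL) -{1}[#|V : _|]muln1.
  rewrite eqn_pmul2l ?indexg_gt0 // eq_sym indexg_eq1 => /subsetP sLW.
  by case/negP: notWv; rewrite sLW // mem_gen ?setU11.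
have sVZ : [~: V, P] \subset W.
  have nWV := subset_trans (normal_sub nVP) (normal_norm nWP).
  (* [V / W] has order p and is normal in the nilpotent group [P / W]. It meets the centre
     nontrivially, hence is central. *)
  rewrite -quotient_cents2 // ?normal_norm //.
  have oVW : prime #|V / W| by rewrite card_quotient // idxVW.
  have ntVW : V / W != 1 by rewrite -cardG_gt1 prime_gt1.
  have nilPW : nilpotent (P / W) by rewrite quotient_nil ?(pgroup_nil pP).
  have := meet_center_nil nilPW (quotient_normal W nVP) ntVW.
  by move/(prime_meetG oVW)/subset_trans; apply; apply: subsetIr.
rewrite /=; have -> : 'C_P(V) = 'C_('C_P(W))[v].
  by rewrite defV cent_gen centU -cent_set1 setIA setIAC.
rewrite index_cent1.
have sub : v ^: 'C_P(W) \subset v *: W.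
  apply/subsetP=> _ /imsetP[x /setIP[Px _] ->].
  rewrite mem_lcoset -commgEl (subsetP sVZ) // mem_commg //.
have := subset_leq_card sub; rewrite card_lcoset cW => le.
rewrite -(leq_exp2l _ _ (prime_gt1 p_pr)) (leq_trans _ le) // dvdn_leq //.
  by rewrite -index_cent1.
exact: pfactor_dvdnn.
Qed.

(** * Generating a filtered group by lifting symbols *)

Section Filtration.

(* T i is the graph of a multivalued homomorphism K i -> E, the symbol map,
   well defined modulo Z. *)
Variables (p : nat) (gT rT : finGroupType).
Variables (K : nat -> {group gT}) (T : nat -> {group gT * rT}) (E Z : {group rT}).
Hypotheses (pE : p.-group E)
  (decrK : forall i, K i.+1 \subset K i)
  (subT : forall i x w, (x, w) \in T i -> x \in K i /\ w \in E)
  (totT : forall i x, x \in K i -> exists w, (x, w) \in T i)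
  (kerT : forall i w, w \in Z -> (1, w) \in T i)
  (stepK : forall i x w, (x, w) \in T i -> w \in Z -> x \in K i.+1).

Let U i := (@snd gT rT @* T i)%G.
Let R i (S : {set gT}) := (@snd gT rT @* (T i :&: setX <<S>> setT))%G.

Let mem_R i (S : {set gT}) w :
  reflect (exists2 x, x \in <<S>> & (x, w) \in T i) (w \in R i S).
Proof.
apply: (iffP morphimP) => [[[x y] _ /setIP[Txy /setXP[Sx _]] ->] | [x Sx Txw]].
  by exists x.
by exists (x, w); rewrite ?inE ?Txw ?Sx.
Qed.

Let mem_U i w : reflect (exists x, (x, w) \in T i) (w \in U i).
Proof.
apply: (iffP morphimP) => [[[x y] _ Txy ->] | [x Txw]]; first by exists x.
by exists (x, w); rewrite ?inE.
Qed.

(** New generators are lifts of elements generating [U i] over [H]. Any x in [K i] then shares a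
    symbol with some y in [<<S>>], and y^-1 x has trivial symbol, so [stepK] puts it in [K i.+1]. *)
Let filtration_step i (H : {group rT}) (S0 : {set gT}) :
    H \subset U i -> H \subset R i S0 ->
  exists S : {set gT},
    [/\ S0 \subset S, S \subset S0 :|: K i, U i \subset R i S,
        K i \subset <<S :|: K i.+1>>
      & (#|S| <= #|S0| + logn p #|U i : H|)%N].
Proof.
move=> sHU sHR; have pU : p.-group (U i).
  apply: pgroupS pE; apply/subsetP=> w /mem_U[x].
  by case/subT.
have [V [sVU cV genV]] := pgroup_gen_index _ _ _ _ pU sHU.
pose f v := odflt 1 [pick x | (x, v) \in T i].
have fP v : v \in V -> (f v, v) \in T i.
  move/(subsetP sVU)/mem_U=> [x Txv]; rewrite /f.
  by case: pickP => [//|/(_ x)]; rewrite Txv.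
have sUR : U i \subset R i (S0 :|: f @: V).
  rewrite -genV gen_subG subUset; apply/andP; split; apply/subsetP=> w.
    move=> Vw; apply/mem_R; exists (f w); last exact: fP.
    by rewrite mem_gen // inE imset_f ?orbT.
  move/(subsetP sHR)/mem_R=> [x Sx Tx]; apply/mem_R; exists x => //.
  by rewrite (subsetP (genS (subsetUl _ _)) x).
exists (S0 :|: f @: V); split=> //; first exact: subsetUl.
- rewrite setUS //; apply/subsetP=> _ /imsetP[v /fP Tv ->].
  by case/subT: Tv.
- apply/subsetP=> x /[dup] Kx /totT[w Tw].
  have /mem_R[y Sy Ty] : w \in R i (S0 :|: f @: V).
    by apply: (subsetP sUR); apply/mem_U; exists x.
  rewrite -[x](mulKVg y) groupM //.
    by rewrite (subsetP (genS (subsetUl _ _)) y).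
  rewrite mem_gen // inE; apply/orP; right; apply: (stepK _ _ (w^-1 * w)).
    exact: (groupM (groupVr Ty) Tw).
  by rewrite mulVg group1.
- apply: leq_trans (leq_of_leqif (leq_card_setU _ _)) _.
  by rewrite leq_add2l (leq_trans (leq_imset_card _ _)).
Qed.

(* Since the symbol groups U i increase with i, successive new generators cost
   logn p #|U i.+1 : U i|, and the total telescopes. *)
Lemma filtration_gen n :
    (forall i x w, (i < n)%N -> (x, w) \in T i -> (x ^+ p, w) \in T i.+1) ->
  exists S : {set gT},
    [/\ S \subset K 0, (#|S| <= logn p #|E : Z|)%N & K 0 \subset <<S :|: K n.+1>>].
Proof.
move=> powT.
have sZU i : Z \subset U i by apply/subsetP=> w Zw; apply/mem_U; exists 1; apply: kerT.
have sUE i : U i \subset E by apply/subsetP=> w /mem_U[x /subT[]].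
have sK0 i : K i \subset K 0.
  by elim: i => // i IHi; apply: subset_trans (decrK i) IHi.
have logZ (H L : {group rT}) : Z \subset H -> H \subset L ->
  logn p #|L : Z| = (logn p #|L : H| + logn p #|H : Z|)%N.
- by move=> sZH sHL; rewrite -(Lagrange_index sHL sZH) lognM.
(* The induction also carries [U n \subset R n S]: words in [S] realise every symbol of level n.
   Their p-th powers realise the same symbols at level n + 1, so only [U n.+1] modulo [U n] needs
   new generators. *)
have [S [sSK cS _ genK]] : exists S : {set gT},
    [/\ S \subset K 0, (#|S| <= logn p #|U n : Z|)%N, U n \subset R n S
      & K 0 \subset <<S :|: K n.+1>>].
- elim: n powT => [|n IHn] powT.
    have [|S [_ sSK sUR genK cS]] := filtration_step 0 Z set0 (sZU 0).
      by apply/subsetP=> w Zw; apply/mem_R; exists 1; rewrite ?group1 ?kerT.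
    by exists S; split; rewrite // ?cards0 in sSK cS *; rewrite set0U in sSK.
  have [|S0 [sSK0 cS0 sUR0 genK0]] := IHn.
    by move=> i x w ltin; apply/powT/ltnW.
  have sUU : U n \subset U n.+1.
    apply/subsetP=> w /mem_U[x Tx]; apply/mem_U; exists (x ^+ p).
    exact: powT.
  have [|S [sS0S sSK sUR genK cS]] := filtration_step n.+1 (U n) S0 sUU.
    apply/subsetP=> w /(subsetP sUR0)/mem_R[x Sx Tx]; apply/mem_R.
    by exists (x ^+ p); [rewrite groupX | apply: powT].
  exists S; split=> //.
  + by rewrite (subset_trans sSK) // subUset sSK0 sK0.
  + rewrite (logZ _ _ (sZU n) sUU) addnC (leq_trans cS) // leq_add2r //.
  + apply: subset_trans genK0 _; rewrite gen_subG subUset genK andbT.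
    by rewrite (subset_trans sS0S) ?(subset_trans (subsetUl _ _) (subset_gen _)).
exists S; split=> //; apply: leq_trans cS _.
by rewrite (logZ _ _ (sZU n) (sUE n)) leq_addl.
Qed.

End Filtration.

(** * Action of a p-group on an abelian normal subgroup *)

Section AbelianNormal.

Variables (p : nat) (gT : finGroupType) (P B : {group gT}).
Hypotheses (pP : p.-group P) (nsBP : B <| P) (abB : abelian B).

Let K i := [group of 'C_P(B / 'Mho^i(B) | 'Q)].

Let pB : p.-group B. Proof. exact: pgroupS (normal_sub nsBP) pP. Qed.

Let nMhoP i : P \subset 'N('Mho^i(B)).
Proof. exact: char_norm_trans (Mho_char i B) (normal_norm nsBP). Qed.

Let nBP x : x \in P -> x \in 'N(B).
Proof. exact: (subsetP (normal_norm nsBP)). Qed.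

Let sMhoB i x : x \in 'Mho^i(B) -> x \in B.
Proof. exact: (subsetP (Mho_sub i B)). Qed.

Let MhoW i j x : x \in 'Mho^j(B) -> (i <= j)%N -> x \in 'Mho^i(B).
Proof. by move=> Mx leij; apply: (subsetP (Mho_leq _ leij)). Qed.

Let commBP b x : b \in B -> x \in P -> [~ b, x] \in B.
Proof. by move=> Bb Px; rewrite groupMl ?groupV // memJ_norm // nBP. Qed.

Let commuteB x y : x \in B -> y \in B -> commute x y.
Proof. by move=> Bx By; apply: (centsP abB). Qed.

Let mem_K i x :
  reflect (x \in P /\ forall b, b \in B -> [~ b, x] \in 'Mho^i(B)) (x \in K i).
Proof.
have nMB : B \subset 'N('Mho^i(B)) := subset_trans (normal_sub nsBP) (nMhoP i).
rewrite in_setI astabQR // inE; apply: (iffP and3P) => [[Px _ sxB] | [Px Kx]]; split=> //.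
- move=> b Bb; rewrite -invg_comm groupV (subsetP sxB) //.
  by rewrite mem_commg ?inE.
- by rewrite (subsetP (nMhoP i)).
- rewrite gen_subG; apply/subsetP=> _ /imset2P[_ b /set1P-> Bb ->].
  by rewrite -invg_comm groupV Kx.
Qed.

Let MhoX i j c : c \in 'Mho^i(B) -> c ^+ (p ^ j) \in 'Mho^(i + j)(B).
Proof.
rewrite !(MhoEabelian _ pB abB) => /imsetP[d Bd ->].
by apply/imsetP; exists d; rewrite // -expgM -expnD.
Qed.

Let commXl c n x : c \in B -> x \in P -> [~ c ^+ n, x] = [~ c, x] ^+ n.
Proof.
move=> Bc Px; elim: n => [|n IHn]; first by rewrite comm1g.
rewrite !expgS commMgJ IHn; congr (_ * _).
by apply/conjg_fixP/commgP/commuteB; rewrite ?groupX ?commBP.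
Qed.

Let comm_Mho i j c x : c \in 'Mho^i(B) -> x \in K j -> [~ c, x] \in 'Mho^(i + j)(B).
Proof.
rewrite (MhoEabelian i pB abB) => /imsetP[d Bd ->] /mem_K[Px Kx].
by rewrite commXl // addnC MhoX ?Kx.
Qed.

Section Relation.

Variable S : {set gT}.
Hypothesis genS : <<S>> = B.

Let I := {b : gT | b \in S}.
Let rT := {dffun forall _ : I, gT}.

(* In additive notation: x acts on each generator b of B as b |-> b + p^i w_b
   modulo p^(i+1) B. *)
Definition Mho_rel i : {set gT * rT} :=
  [set u : gT * rT | (u.1 \in K i) && [forall b : I,
    (u.2 b \in B) && ([~ val b, u.1] * (u.2 b ^+ (p ^ i))^-1 \in 'Mho^i.+1(B))]].

Let E := setXn_group (fun _ : I => B).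
Let Z := setXn_group (fun _ : I => 'Mho^1(B)%G).

Let Sb (b : I) : val b \in B.
Proof. by rewrite -genS mem_gen // (valP b). Qed.

Let mem_T i x w :
  reflect [/\ x \in K i, w \in E
     & forall b, [~ val b, x] * (w b ^+ (p ^ i))^-1 \in 'Mho^i.+1(B)]
    ((x, w) \in Mho_rel i).
Proof.
apply: (iffP setIdP) => /= [[Kx /forallP Tx] | [Kx /setXnP Ew Tx]].
  by split=> // [|b]; [apply/setXnP=> b; case/andP: (Tx b) | case/andP: (Tx b)].
by split=> //; apply/forallP=> b; rewrite Ew Tx.
Qed.

(** Symbols add up to the error [[~ [~ b, x], y]], which lies in ['Mho^(i + i)(B)]. This is inside
    ['Mho^i.+1(B)] exactly because i is positive. *)
Let group_T i : (0 < i)%N -> group_set (Mho_rel i).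
Proof.
move=> i_gt0; apply/group_setP; split.
  apply/mem_T; split=> //=; try exact: group1.
  by move=> b; rewrite commg1 ffunE expg1n invg1 mulg1 group1.
move=> [x w] [y z] /mem_T[Kx Ew Tx] /mem_T[Ky Ez Ty]; apply/mem_T; split.
- exact: groupM.
- exact: groupM.
move=> b; rewrite /= ffunE.
have Bw := setXnP Ew b; have Bz := setXnP Ez b.
have [[Px KxB] [Py KyB]] := (mem_K _ _ Kx, mem_K _ _ Ky).
have Bx := commBP _ _ (Sb b) Px; have By := commBP _ _ (Sb b) Py.
have -> : [~ val b, x * y] * ((w b * z b) ^+ (p ^ i))^-1
    = ([~ val b, y] * (z b ^+ (p ^ i))^-1)
      * ([~ val b, x] * (w b ^+ (p ^ i))^-1) * [~ [~ val b, x], y].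
  rewrite expgMn; last exact: commuteB.
  rewrite commgMJ (conjg_mulR [~ val b, x]).
  have Bc := commBP _ _ Bx Py; move: Bc Bx By.
  move: [~ val b, y] [~ val b, x] [~ [~ val b, x], y] => u v c Bc Bv Bu.
  rewrite invMg -!mulgA; congr (_ * _).
  rewrite (commuteB c) ?groupM ?groupV ?groupX //.
  rewrite !mulgA; congr (_ * _ * _).
  by rewrite (commuteB v) // groupV groupX.
apply: groupM; first exact: groupM.
have := comm_Mho _ _ _ _ (KxB _ (Sb b)) Ky.
by move=> Mc; apply: MhoW Mc _; rewrite -addn1 leq_add2l.
Qed.

(** Taking the generated group gives a group for every i, including 0; for positive i it is
    [Mho_rel i] itself. *)
Let T i := <<Mho_rel i>>%G.

Let mem_TG i x w : (0 < i)%N -> ((x, w) \in T i) = ((x, w) \in Mho_rel i).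
Proof. by move=> i_gt0; rewrite /= gen_set_id ?group_T. Qed.

(** As [B] is abelian, b |-> [[~ b, x]] is multiplicative on [B], so the condition extends from [S]
    to [B]. *)
Let mem_K_gen i x :
  x \in P -> (forall b : I, [~ val b, x] \in 'Mho^i(B)) -> x \in K i.
Proof.
move=> Px Kx; apply/mem_K; split=> //.
have gL : group_set [set b in B | [~ b, x] \in 'Mho^i(B)].
  apply/group_setP; split=> [|c d]; first by rewrite inE comm1g !group1.
  rewrite !inE => /andP[Bc Mc] /andP[Bd Md].
  have /conjg_fixP fixc : [~ [~ c, x], d] == 1 by apply/commgP/commuteB; rewrite ?commBP.
  by rewrite groupM // commMgJ fixc groupM.
have sBL : <<S>> \subset Group gL.
  rewrite gen_subG; apply/subsetP=> b Sb'.
  by rewrite inE (Kx (exist _ b Sb')) (Sb (exist _ b Sb')).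
by rewrite genS in sBL; move=> b /(subsetP sBL); rewrite inE => /andP[].
Qed.

(* [~ [~ b, x], x] lies in 'Mho^(2 * j)(B), and 2 * j >= j + 2: this is why the
   chain of symbols starts at level 2, for all p including 2. *)
Let comm_expg_Mho j x b m : (1 < j)%N -> x \in K j -> b \in B ->
  [~ b, x ^+ m] * ([~ b, x] ^+ m)^-1 \in 'Mho^j.+2(B).
Proof.
move=> j_gt1 Kx Bb; have [Px KxB] := mem_K _ _ Kx.
have Ba := commBP _ _ Bb Px.
elim: m => [|m IHm]; first by rewrite commg1 invg1 mulg1 group1.
have Kxm : x ^+ m \in K j by rewrite groupX.
have [Pxm /(_ b Bb) Mc] := mem_K _ _ Kxm.
have Mcx : [~ [~ b, x ^+ m], x] \in 'Mho^j.+2(B).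
  by apply: MhoW (comm_Mho _ _ _ _ Mc Kx) _; rewrite -addn2 leq_add2l.
rewrite expgSr commgMJ (conjg_mulR [~ b, x ^+ m]).
have Bc := sMhoB _ _ Mc.
have Bd := commBP _ _ Bc Px.
rewrite (commuteB _ _ Ba (groupM Bc Bd)) expgSr invMg mulgA mulgK -mulgA.
rewrite (commuteB _ ([~ b, x] ^+ m)^-1 Bd) ?groupV ?groupX // mulgA.
exact: groupM.
Qed.

(** The abstract filtration is applied from level s onwards. With n = 0 no p-th powers are taken, so
    s = 1 is allowed; longer chains start at s >= 2. *)
Lemma Mho_filtration_gen s n : (0 < s)%N -> (1 < s)%N || (n == 0)%N ->
  exists R : {set gT},
    [/\ R \subset K s, (#|R| <= logn p #|E : Z|)%N & K s \subset <<R :|: K (s + n.+1)>>].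
Proof.
move=> s_gt0 sn.
have pE : p.-group E.
  by rewrite /pgroup cardsXn prod_nat_const pnatX (pB : p.-nat #|B|).
have Ts i x w : ((x, w) \in T (s + i)) = ((x, w) \in Mho_rel (s + i)).
  by rewrite mem_TG // addn_gt0 s_gt0.
have [i|i x w|i x|i w|i x w|i x w|R [sRK cR genR]] := 
  filtration_gen p _ _ (fun i => K (s + i)) (fun i => T (s + i)) E Z pE _ _ _ _ _ n.
- apply/subsetP=> x /mem_K[Px Kx]; apply/mem_K; split=> // b /Kx Mb.
  by apply: MhoW Mb _; rewrite leq_add2l.
- by rewrite Ts => /mem_T[].
- move=> Kx; have [Px KxB] := mem_K _ _ Kx.
  have ex (b : I) : exists w, (w \in B) && ([~ val b, x] * (w ^+ (p ^ (s + i)))^-1 \in 'Mho^(s + i).+1(B)).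
    have := KxB _ (Sb b); rewrite (MhoEabelian _ pB abB) => /imsetP[d Bd ->].
    by exists d; rewrite Bd mulgV group1.
  exists [ffun b : I => xchoose (ex b)].
  rewrite Ts; apply/mem_T; split=> //.
    by apply/setXnP=> b; rewrite ffunE; case/andP: (xchooseP (ex b)).
  by move=> b; rewrite ffunE; case/andP: (xchooseP (ex b)).
- move=> /setXnP Zw; rewrite Ts; apply/mem_T; split=> //.
    by apply/setXnP=> b; apply: sMhoB (Zw b).
  by move=> b; rewrite commg1 mul1g groupV -add1n MhoX.
- rewrite Ts => /mem_T[Kx Ew Tx] /setXnP Zw.
  have [Px _] := mem_K _ _ Kx.
  rewrite /= addnS; apply: mem_K_gen => // b.
  have Mw : w b ^+ (p ^ (s + i)) \in 'Mho^(s + i).+1(B) by rewrite -add1n MhoX.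
  by have := groupM (Tx b) Mw; rewrite mulgKV.
- move=> ltin; rewrite !Ts addnS => /mem_T[Kx Ew Tx].
  (* Here i < n, so n is nonzero and [sn] forces s > 1. *)
  have j_gt1 : (1 < s + i)%N by case: n sn ltin => // n; rewrite orbF => /ltn_addr->.
  move: (s + i)%N j_gt1 Kx Tx => j j_gt1 Kx Tx.
  have [Px KxB] := mem_K _ _ Kx.
  (* Modulo ['Mho^j.+2(B)], [[~ b, x ^+ p]] agrees with [[~ b, x] ^+ p], which agrees with the p-th
     power of [w b ^+ (p ^ j)]. Thus x^p has the same symbol one level up. *)
  have powx b : [~ val b, x ^+ p] * (w b ^+ (p ^ j.+1))^-1 \in 'Mho^j.+2(B).
    have Bw : w b \in B := setXnP Ew b.
    have Ba : [~ val b, x] \in B := commBP _ _ (Sb b) Px.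
    rewrite -[X in X * _](mulgKV ([~ val b, x] ^+ p)) -mulgA groupM ?comm_expg_Mho //.
    rewrite expnS mulnC expgM -expgVn -expgMn; last by apply: commuteB; rewrite ?groupV ?groupX.
    by have := MhoX _ 1 _ (Tx b); rewrite expn1 addn1.
  apply/mem_T; split=> //.
  apply: mem_K_gen => [|b]; first exact: groupX.
  rewrite -[[~ _, _]](mulgKV (w b ^+ (p ^ j.+1))) groupM //.
    by apply: MhoW (powx b) _.
  by rewrite (MhoX 0) // Mho0; apply: (setXnP Ew b).
by rewrite addn0 in sRK genR; exists R.
Qed.

Lemma logn_index_setXn_Mho : logn p #|E : Z| = (#|S| * logn p #|B : 'Mho^1(B)|)%N.
Proof.
have sZE : Z \subset E by apply: setXnS => b; apply: Mho_sub.
rewrite -divgS // !cardsXn !prod_nat_const.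
rewrite -(Lagrange (Mho_sub 1 B)) expnMn mulKn ?expn_gt0 ?cardG_gt0 //.
by rewrite lognX card_sig; congr (_ * _)%N; apply: eq_card.
Qed.

End Relation.

(** The index equals the order of ['Ohm_1(B)], whose logarithm is the rank of [B]. *)
Lemma logn_index_Mho1 : logn p #|B : 'Mho^1(B)| = 'm(B).
Proof.
rewrite -divgS ?Mho_sub // -(mul_card_Ohm_Mho_abelian 1 abB) mulnK ?cardG_gt0 //.
by rewrite -p_rank_abelian // -rank_pgroup // grank_abelian.
Qed.

Lemma gen_mod_cent_abelian :
  exists R : {set gT},
    [/\ R \subset P, (#|R| <= 'C('m(B), 2) + 2 * 'm(B) ^ 2)%N
      & P \subset <<R :|: 'C_P(B)>>].
Proof.
have [S defB cS] := grank_witness B.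
have sK0 i : K i \subset P by apply: subsetIl.
have [R0 [sR0 cR0 genR0]] : exists R : {set gT},
  [/\ R \subset P, (#|R| <= 'C('m(B), 2))%N & <<R :|: K 1%N>> = P].
- have [R [sR cR genR]] := pgroup_gen_index _ _ _ _ pP (sK0 1%N).
  exists R; split=> //; apply: leq_trans cR _.
  pose M := 'Mho^1(B)%G.
  have nsMP : M <| P := char_normal_trans (Mho_char 1 B) nsBP.
  have nMB : B \subset 'N(M) := subset_trans (normal_sub nsBP) (normal_norm nsMP).
  have sMK : M \subset K 1%N.
    apply/subsetP=> x Mx; apply/mem_K; rewrite (subsetP (normal_sub nsMP)) //.
    split=> // b Bb; have /commgP/eqP-> := commuteB _ _ Bb (sMhoB _ _ Mx).
    exact: group1.
  (* Since [B] is abelian, [M] lies in [K 1], so the index can be computed in [P / M] acting on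
     [B / M], a group of order p to the power ['m(B)]. *)
  have -> : #|P : K 1%N| = #|P / M : 'C_(P / M)(B / M)|.
    rewrite -quotient_astabQ -quotientGI ?normal_sub //.
    rewrite -[RHS]/(#|P / M : K 1%N / M|) index_quotient_eq ?normal_norm //.
    by rewrite (subset_trans (subsetIr _ _)).
  have := logn_index_cent _ _ _ _ _ (quotient_pgroup M pP) (quotient_normal M nsBP)
    (card_pgroup (quotient_pgroup M pB)).
  by rewrite card_quotient // logn_index_Mho1.
(* The single layer from [K 1] to [K 2]. *)
have [R1 [sR1 cR1 genR1]] := Mho_filtration_gen S defB 1%N 0 isT isT.
have [e cB] : {e | #|B| = (p ^ e)%N} by apply/p_natP.
(* The length e, with p^e the order of [B], reaches a level that centralises [B], because
   ['Mho^e(B)] is trivial. *)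
have [R2 [sR2 cR2 genR2]] := Mho_filtration_gen S defB 2 e isT isT.
rewrite logn_index_setXn_Mho logn_index_Mho1 cS in cR1 cR2.
have cardU (U V : {set gT}) m n : (#|U| <= m)%N -> (#|V| <= n)%N -> (#|U :|: V| <= m + n)%N.
  by move=> cU cV; apply: leq_trans (leq_of_leqif (leq_card_setU _ _)) (leq_add cU cV).
exists (R0 :|: R1 :|: R2); split.
- by rewrite !subUset sR0 (subset_trans sR1 (sK0 _)) (subset_trans sR2 (sK0 _)).
- by rewrite mul2n -addnn addnA !cardU.
have sKC : K (2 + e.+1) \subset 'C_P(B).
  apply/subsetP=> x /mem_K[Px Kx]; rewrite inE Px; apply/centP=> b Bb.
  apply/esym/commgP.
  have : [~ b, x] \in 'Mho^e(B).
    by apply: MhoW (Kx b Bb) _; rewrite addnS leqW ?leq_addl.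
  by rewrite (MhoEabelian _ pB abB) => /imsetP[d Bd ->]; rewrite -cB expg_cardG.
have sgen (U V : {set gT}) : U \subset V -> U \subset <<V>>.
  by move=> sUV; apply: subset_trans sUV (subset_gen V).
have sP : P \subset <<R0 :|: K 1%N>> by rewrite genR0.
apply: subset_trans sP _; rewrite gen_subG subUset; apply/andP; split.
  by rewrite sgen // -!setUA subsetUl.
apply: subset_trans genR1 _; rewrite gen_subG subUset; apply/andP; split.
  by apply/sgen/subsetP=> x; rewrite !inE => ->; rewrite !orbT.
apply: subset_trans genR2 _; rewrite genS // setUSS ?subsetUr //.
Qed.

End AbelianNormal.

(** * Index bounds around a self-centralising abelian subgroup *)

Lemma card_abelian_le (gT : finGroupType) (G : {group gT}) :
  abelian G -> (#|G| <= exponent G ^ 'm(G))%N.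
Proof.
move=> abG; have [b defG ordb] := abelian_structure abG.
rewrite grank_abelian // -size_abelian_type // -ordb size_map -(bigdprod_card defG).
have {defG}: {in b, forall x, #[x] <= exponent G}%N.
  move=> x bx; rewrite dvdn_leq ?exponent_gt0 ?dvdn_exponent //.
  by rewrite -(bigdprodWY defG) mem_gen // (big_rem x bx) inE cycle_id.
elim: b {ordb} => [|x b IHb] leb; first by rewrite big_nil.
rewrite big_cons expnS leq_mul ?leb ?mem_head // IHb // => y by_.
by rewrite leb // inE by_ orbT.
Qed.

(** ['C_D(S)] is an intersection of point stabilisers, and each costs at most the length of one
    conjugacy orbit. *)
Lemma index_cent_le (gT : finGroupType) (D : {group gT}) (S : {set gT}) n :
  (forall a, a \in S -> #|a ^: D| <= n)%N -> (#|D : 'C_D(S)| <= n ^ #|S|)%N.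
Proof.
have [m] := ubnP #|S|; elim: m S => // m IHm S ltSm leS.
have [-> | [a Sa]] := set_0Vmem S.
  have -> : 'C_D(set0) = D by apply/setIidPl/subsetP=> x _; apply/centP=> y; rewrite inE.
  by rewrite indexgg cards0.
have cS : #|S| = #|S :\ a|.+1 by rewrite (cardsD1 a) Sa.
have sCC : 'C_D(S) \subset 'C_D(S :\ a) by rewrite setIS // centS // subsetDl.
rewrite -(Lagrange_index (subsetIl D _) sCC) cS expnSr leq_mul //.
  by apply: IHm => [|b /setD1P[_ /leS] //]; rewrite -ltnS -cS.
apply: leq_trans (leS a Sa); rewrite -index_cent1.
rewrite /=; have -> : 'C_D(S) = 'C_D(S :\ a) :&: 'C_D[a].
    by rewrite setIACA setIid -[in LHS](setD1K Sa) centU cent_set1 ['C[a] :&: _]setIC.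
by rewrite indexgI subset_leq_card // imsetS // subsetIl.
Qed.

Lemma Mho_sub_index (p e : nat) (gT : finGroupType) (A B : {group gT}) :
  p.-group A -> abelian A -> B \subset A -> #|A : B| = (p ^ e)%N -> 'Mho^e(A) \subset B.
Proof.
move=> pA abA sBA idx; have nBA : A \subset 'N(B) := sub_abelian_norm abA sBA.
rewrite (MhoEabelian _ pA abA); apply/subsetP=> _ /imsetP[a Aa ->].
have NBa := subsetP nBA a Aa.
rewrite coset_idr ?groupX // morphX // -idx -card_quotient //.
by rewrite expg_cardG // mem_quotient.
Qed.

(** Let D be the centraliser of ['Mho^e(A)]. An element of D fixes a^(p^e), so it moves a within the
    coset of ['Ohm_e(A)], which has n = [#|A : 'Mho^e(A)|] elements. At most n elements generate A
    over ['Mho^e(A)], and their centraliser in D is A; so the index of A in D is at most n^n, and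
    one more factor n leads from A down to ['Mho^e(A)]. *)
Lemma cent_Mho_index (p e : nat) (gT : finGroupType) (P A : {group gT}) :
  p.-group P -> A <| P -> abelian A -> 'C_P(A) = A ->
  (#|'C_P('Mho^e(A)) : 'Mho^e(A)| <= #|A : 'Mho^e(A)| ^ (#|A : 'Mho^e(A)|).+1)%N.
Proof.
move=> pP nsAP abA scA; set n := #|A : _|.
have sAP := normal_sub nsAP; have pA := pgroupS sAP pP.
pose D := 'C_P('Mho^e(A))%G.
have sAD : A \subset D by rewrite subsetI sAP (subset_trans abA) ?centS ?Mho_sub.
rewrite -(Lagrange_index sAD (Mho_sub e A)) expnS mulnC leq_mul //.
have [S [sSA cS genS]] := pgroup_gen_index _ _ _ _ pA (Mho_sub e A).
have -> : #|D : A| = #|D : 'C_D(S)|.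
  rewrite -[in LHS]scA; congr #|D : _|; apply/setP=> x.
  apply/setIP/setIP=> -[Dx]; last first.
    case/setIP: Dx => Px cx cS'; split=> //.
    by rewrite -genS cent_gen centU inE cS' cx.
  move=> cAx; split; last by apply: subsetP cAx; rewrite centS.
  by rewrite inE Dx (subsetP (centS (Mho_sub e A))).
have ltlog : (logn p n <= n)%N.
  by rewrite ltnW // ltn_logl // indexg_gt0.
have nO : #|'Ohm_e(A)| = n.
  by rewrite /n -divgS ?Mho_sub // -(mul_card_Ohm_Mho_abelian e abA) mulnK ?cardG_gt0.
apply: leq_trans (index_cent_le _ _ _ n _) _ => [a Sa|]; last first.
  by rewrite leq_pexp2l ?indexg_gt0 // (leq_trans cS).
have Aa := subsetP sSA a Sa.
rewrite -nO -(card_lcoset 'Ohm_e(A) a) subset_leq_card //; apply/subsetP=> _ /imsetP[x /setIP[Px cx] ->].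
rewrite mem_lcoset (OhmEabelian pA) ?(abelianS (Ohm_sub _ _)) //.
have Aax : a ^ x \in A by rewrite memJ_norm // (subsetP (normal_norm nsAP)).
rewrite !inE groupM ?groupV //=.
rewrite expgMn; last by apply: (centsP abA); rewrite ?groupV.
rewrite expgVn -conjXg /conjg.
have /(centP cx) <- : a ^+ (p ^ e) \in 'Mho^e(A).
  by rewrite (MhoEabelian _ pA abA); apply/imsetP; exists a.
by rewrite mulKg mulVg.
Qed.

(** The final summand m counts generators of the abelian subgroup itself. The left side equals m(5m
    + 1)/2, which is monotone in m. *)
Lemma gen_count_le m k :
  (m <= k -> 'C(m, 2) + 2 * m ^ 2 + m <= (k * (5 * k + 1)) %/ 2)%N.
Proof.
move=> lemk; rewrite leq_divRL //.
have bin2M : ('C(m, 2) * 2 + m = m * m)%N.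
  by rewrite (bin_ffact m 2) !ffactnS ffactn0 muln1 -mulnSr; case: (m).
have -> : (('C(m, 2) + 2 * m ^ 2 + m) * 2 = m * (5 * m + 1))%N.
  by rewrite -mulnn mulnDr muln1 mulnCA; lia.
by rewrite leq_mul // leq_add2r leq_mul2l.
Qed.

(** * The bound for p-groups *)

Lemma pgroup_bounded_gen (k C p : nat) (gT : finGroupType) (P : {group gT}) :
    p.-group P ->
    (forall A : {group gT}, A \subset P -> abelian A ->
      exists B : {group gT}, [/\ B \subset A, (#|A : B| <= C)%N & ('m(B) <= k)%N]) ->
  exists Q : {group gT},
    [/\ Q \subset P, ('m(Q) <= (k * (5 * k + 1)) %/ 2)%N &
      (#|P : Q| <= if (p <= C)%N then (C ^ k.+1) ^ (C ^ k.+1).+1 else 1)%N].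
Proof.
move=> pP hyp.
have [A maxA _] := @maxgroup_exists _ (fun A : {group gT} => (A <| P) && abelian A) 1%G
  (introT andP (conj (normal1 P) (abelian1 gT))).
have [nsAP abA] := andP (maxgroupp maxA).
have scA : 'C_P(A) = A by have [] := SCN_P (max_SCN pP maxA).
have sAP := normal_sub nsAP; have pA := pgroupS sAP pP.
have [B [sBA idxB mB]] := hyp A sAP abA.
have [e idxe] : {e | #|A : B| = (p ^ e)%N}.
  by apply/p_natP/(pnat_dvd (dvdn_indexg _ _)).
have abB := abelianS sBA abA.
have sMB := Mho_sub_index _ _ _ _ _ pA abA sBA idxe.
pose B0 := 'Mho^e(A)%G.
have mB0 : ('m(B0) <= k)%N.
  apply: leq_trans mB; rewrite !grank_abelian ?rankS //.
  exact: abelianS (Mho_sub e A) abA.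
have C_gt0 : (0 < C)%N by apply: leq_trans idxB.
have idxB0 : (#|A : B0| <= if (p <= C)%N then C ^ k.+1 else 1)%N.
  case: (leqP p C) => [_ | ltCp].
    (* The first factor is at most C. The second is at most [#|B : 'Mho^e(B)|], the order of
       ['Ohm_e(B)]; this group has rank at most k and exponent dividing p^e <= C, so its order is at
       most C^k. *)
    have -> : #|A : B0| = (#|A : B| * #|B : B0|)%N by rewrite Lagrange_index.
    rewrite expnS leq_mul //.
    apply: (@leq_trans #|B : 'Mho^e(B)|).
      by rewrite dvdn_leq ?indexg_gt0 // indexgS // MhoS.
    rewrite -divgS ?Mho_sub // -(mul_card_Ohm_Mho_abelian e abB) mulnK ?cardG_gt0 //.
    have abO : abelian 'Ohm_e(B) := abelianS (Ohm_sub e B) abB.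
    apply: leq_trans (card_abelian_le _ _ abO) _.
    apply: (@leq_trans (C ^ 'm('Ohm_e(B)))).
      case: ('m(_)) => // m; rewrite leq_exp2r // (leq_trans _ idxB) // idxe.
      apply: dvdn_leq; first by rewrite -idxe indexg_gt0.
      apply/exponentP=> x; rewrite /= (OhmEabelian (pgroupS sBA pA) abO) !inE.
      by case/andP=> _ /eqP.
    rewrite leq_pexp2l //.
    apply: leq_trans mB; by rewrite !grank_abelian ?rankS ?Ohm_sub.
  have e0 : e = 0%N.
    apply/eqP; apply: contraLR ltCp; rewrite -lt0n -leqNgt => e_gt0.
    rewrite (leq_trans _ idxB) // idxe.
    by case: (posnP p) => [-> // | p_gt0]; rewrite -{1}(expn1 p) leq_pexp2l.
  by rewrite /B0 /= e0 Mho0 indexgg.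
have nsB0P : B0 <| P := char_normal_trans (Mho_char e A) nsAP.
have [R [sRP cR genR]] := gen_mod_cent_abelian _ _ _ _ pP nsB0P (abelianS (Mho_sub e A) abA).
have [S defB0 cS] := grank_witness B0.
pose Q := <<R :|: S>>%G.
have sSQ : B0 \subset Q by rewrite -defB0 genS ?subsetUr.
have sQP : Q \subset P.
  by rewrite gen_subG subUset sRP -gen_subG defB0 normal_sub.
exists Q; split=> //.
  apply: leq_trans (grank_min _) _.
  apply: leq_trans (leq_of_leqif (leq_card_setU _ _)) _.
  rewrite cS; apply: leq_trans (leq_add cR (leqnn _)) _.
  exact: gen_count_le.
have nCP : P \subset 'N('C_P(B0)) by rewrite normsI ?normG // norms_cent ?normal_norm.
(* [Q] and ['C_P(B0)] together generate [P] and ['C_P(B0)] is normal, so [P] is their product. *)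
have -> : #|P : Q| = #|'C_P(B0) : Q|.
  rewrite -(indexMg Q 'C_P(B0)); congr #|_ : _|; apply/eqP.
  rewrite eqEsubset; apply/andP; split; last by rewrite mul_subG ?subsetIl.
  rewrite -norm_joinEl ?(subset_trans sQP nCP) // (subset_trans genR) // gen_subG subUset.
  rewrite joing_subr andbT (subset_trans _ (joing_subl _ _)) //.
  exact: subset_trans (subsetUl R S) (subset_gen _).
apply: leq_trans (_ : #|'C_P(B0) : B0| <= _)%N.
  by rewrite dvdn_leq ?indexg_gt0 // indexgS.
apply: leq_trans (cent_Mho_index _ _ _ _ _ pP nsAP abA scA) _.
move: #|A : _| idxB0 => n; case: ifP => _ len.
  apply: leq_trans (_ : (C ^ k.+1) ^ n.+1 <= _)%N; first by rewrite leq_exp2r.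
  by rewrite leq_pexp2l ?expn_gt0 ?C_gt0.
by rewrite -(exp1n n.+1) leq_exp2r.
Qed.

(** * Assembling the Sylow subgroups of a nilpotent group *)

(** The i-th generators of both factors are multiplied together; as they commute and have coprime
    orders, the cyclic group of the product contains both. The default 1 pads the shorter list. *)
Lemma grank_dprod_coprime (gT : finGroupType) (G H L : {group gT}) :
  G \x H = L -> coprime #|G| #|H| -> ('m(L) <= maxn 'm(G) 'm(H))%N.
Proof.
move=> defL coGH; have [_ _ cGH _] := dprodP defL.
have [S defG cS] := grank_witness G; have [T defH cT] := grank_witness H.
pose s i := nth 1 (enum S) i; pose t i := nth 1 (enum T) i.
have Gs i : s i \in G.
  rewrite /s; have [le | lt] := leqP (size (enum S)) i; first by rewrite nth_default.
  by rewrite -defG mem_gen // -mem_enum mem_nth.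
have Ht i : t i \in H.
  rewrite /t; have [le | lt] := leqP (size (enum T)) i; first by rewrite nth_default.
  by rewrite -defH mem_gen // -mem_enum mem_nth.
pose n := maxn 'm(G) 'm(H); pose U := [set s i * t i | i : 'I_n].
have cycU i : (i < n)%N -> <[s i]> * <[t i]> \subset <<U>>.
  move=> ltin; rewrite -cycleM.
  - by rewrite cycle_subG mem_gen //; apply/imsetP; exists (Ordinal ltin).
  - by apply/esym/(centsP cGH).
  - by apply: coprime_dvdl (order_dvdG (Gs i)) _; apply: coprime_dvdr (order_dvdG (Ht i)) _.
have sSU : S \subset <<U>>.
  apply/subsetP=> x Sx; have xS : x \in enum S by rewrite mem_enum.
  have ltxn : (index x (enum S) < n)%N by rewrite leq_max -cS cardE index_mem xS.
  apply: (subsetP (cycU _ ltxn)); rewrite -[X in X \in _]mulg1 mem_mulg ?group1 //.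
  by rewrite /s nth_index // cycle_id.
have sTU : T \subset <<U>>.
  apply/subsetP=> x Tx; have xT : x \in enum T by rewrite mem_enum.
  have ltxn : (index x (enum T) < n)%N by rewrite leq_max -cT [#|T|]cardE index_mem xT orbT.
  apply: (subsetP (cycU _ ltxn)); rewrite -[X in X \in _]mul1g mem_mulg ?group1 //.
  by rewrite /t nth_index // cycle_id.
have defU : <<U>> = L.
  apply/eqP; rewrite eqEsubset; apply/andP; split.
    rewrite gen_subG -(dprodW defL); apply/subsetP=> _ /imsetP[i _ ->].
    exact: mem_mulg.
  by rewrite -(dprodWY defL) join_subG -defG -defH !gen_subG sSU sTU.
rewrite -defU (leq_trans (grank_min _)) // (leq_trans (leq_imset_card _ _)) //.
by rewrite card_ord.
Qed.

(* Induction on m removes the Sylow m-subgroup; only the values m <= C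
   contribute to the index. *)
Lemma nilpotent_bounded_gen (k C m : nat) (gT : finGroupType) (N : {group gT}) :
    [pred p | (p < m)%N].-group N -> in_class_N k C N ->
  exists Q : {group gT},
    [/\ Q \subset N, ('m(Q) <= (k * (5 * k + 1)) %/ 2)%N &
      (#|N : Q| <= ((C ^ k.+1) ^ (C ^ k.+1).+1) ^ minn m C.+1)%N].
Proof.
elim: m N => [|m IHm] N piN [nilN hyp].
  (* No prime is below 0, so the order of [N] has no prime divisor. *)
  have -> : N = 1%G.
    apply/group_inj/eqP; rewrite trivg_card1; apply/negPn/negP => ntN.
    have: pdiv #|N| \in \pi(N) by rewrite pi_pdiv ltn_neqAle eq_sym ntN cardG_gt0.
    by move/(pnatPpi piN).
  exists 1%G; split; rewrite ?indexgg ?min0n //.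
  by have := grank_min (set0 : {set gT}); rewrite gen0 cards0 leqn0 => /eqP->.
have hypS (H A : {group gT}) : H \subset N -> A \subset H -> abelian A ->
  exists B : {group gT}, [/\ B \subset A, (#|A : B| <= C)%N & ('m(B) <= k)%N].
- by move=> sHN sAH; apply: hyp (subset_trans sAH sHN).
have [||H' [sH' mH' iH']] := IHm 'O_m^'(N)%G.
- apply: sub_in_pnat (pcore_pgroup m^' N) => p pO.
  have := pnatPpi (pgroupS (pcore_sub m^' N) piN) pO.
  by rewrite !inE ltnS leq_eqVlt => /orP[-> | ].
- split; first exact: nilpotentS (pcore_sub _ _) nilN.
  by move=> A; apply: hypS; apply: pcore_sub.
have [P' [sP' mP' iP']] := pgroup_bounded_gen k C _ _ _ (pcore_pgroup m N)
  (fun A => hypS 'O_m(N)%G A (pcore_sub _ _)).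
have defN := nilpotent_pcoreC m nilN.
have [_ _ cPH tiPH] := dprodP defN.
have defQ : P' \x H' = P' <*> H'.
  rewrite dprodEY //; first exact: subset_trans sH' (subset_trans cPH (centS sP')).
  by apply/trivgP; rewrite -tiPH setISS.
exists (P' <*> H')%G; split.
- rewrite join_subG (subset_trans sP') ?pcore_sub //.
  by rewrite (subset_trans sH') ?pcore_sub.
- apply: leq_trans (grank_dprod_coprime _ _ _ _ defQ _) _; last by rewrite geq_max mP'.
  apply: (@pnat_coprime m); first exact: pgroupS sP' (pcore_pgroup _ _).
  exact: pgroupS sH' (pcore_pgroup _ _).
have -> : #|N : P' <*> H'| = (#|'O_m(N) : P'| * #|'O_m^'(N) : H'|)%N.
  have sQN : P' <*> H' \subset N.
    by rewrite join_subG (subset_trans sP' (pcore_sub _ _)) (subset_trans sH' (pcore_sub _ _)).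
  apply/eqP; rewrite -(eqn_pmul2l (cardG_gt0 (P' <*> H'))) Lagrange //.
  by rewrite -(dprod_card defQ) mulnACA !Lagrange // (dprod_card defN).
apply: leq_trans (leq_mul iP' iH') _.
(* For m <= C the minimum grows by one and absorbs the new factor; for m > C the new factor is 1 and
   the minimum stays at C + 1. *)
have [leCm | ltCm] := leqP m C.
  have -> : minn m C.+1 = m by apply/minn_idPl/leqW.
  have -> : minn m.+1 C.+1 = m.+1 by apply/minn_idPl; rewrite ltnS.
  by rewrite [leqRHS]expnS.
have -> : minn m C.+1 = C.+1 by apply/minn_idPr.
have -> : minn m.+1 C.+1 = C.+1 by apply/minn_idPr/leqW.
by rewrite mul1n.
Qed.

Theorem theorem7p3 (k C : nat) :
  exists C' : nat,
    forall (gT : finGroupType) (N : {group gT}),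
      in_class_N k C N ->
      exists N' : {group gT},
        [/\ N' \subset N,
            (#|N : N'| <= C')%N
          & ('m(N') <= 1 + (k * (5 * k + 1)) %/ 2)%N].
Proof.
exists (((C ^ k.+1) ^ (C ^ k.+1).+1) ^ C.+1)%N => gT N classN.
(* The cutoff exceeds every prime divisor of [#|N|], and its minimum with C + 1 is C + 1, so the
   exponent is independent of [N]. *)
have [|Q [sQN mQ iQ]] := nilpotent_bounded_gen k C (maxn #|N|.+1 C.+1) gT N _ classN.
  apply/pnatP=> // p _ /dvdn_leq leN.
  by rewrite inE /= leq_max ltnS leN.
exists Q; split=> //; first by rewrite (minn_idPr (leq_maxr _ _)) in iQ.
exact: leqW.
Qed.
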